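(* Suppose $B'(1)<0$, i.e. $m_b<b_0$. Then the quantity $D^2=\sup_{s\in(0,1)}\left\{(-\log s)\int_0^s\frac{1}{B(r)}\,dr\right\}$ satisfies $$\frac{(\log2)^2}{b_0}\le D^2\le\frac{(\log 2)^2}{b_0-m_b},$$ which implies that the decay parameter $\lambda_C$ of the quadratic Markov branching process satisfies $$\frac{b_0-m_b}{4(\log2)^2}\le\lambda_C\le\frac{b_0}{(\log2)^2}.$$
   Context: Let $(b_j)_{j\ge0}$ be a real sequence with $b_j\ge 0$ for $j\ne 1$, $-b_1=\sum_{j\neq1}b_j$, $b_0>0$ and $\sum_{j\ge2}b_j>0$; put $B(s)=\sum_{j\ge0}b_js^j$ and $m_b=\sum_{j\ge2}(j-1)b_j$, so $B'(1)=m_b-b_0$. The quadratic Markov branching process (QMBP) is the continuous-time Markov chain on $\mathbb{Z}_+=\{0,1,2,\dots\}$ with $q$-matrix $q_{ij}=i^2b_{j-i+1}$ if $j\ge i-1$ and $q_{ij}=0$ otherwise (for $m_b\le b_0$ its transition function $P_{ij}(t)$ is unique and is the Feller minimal one). Its communicating class is $C=\{1,2,\dots\}$, and its decay parameter is $\lambda_C=-\lim_{t\to\infty}\frac1t\log P_{ij}(t)$, $i,j\in C$ (the limit exists and does not depend on $i,j\in C$). *)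

(* Defs.v *)
From Stdlib Require Import Reals.
From Coquelicot Require Import Coquelicot.
Open Scope R_scope.

Record branching_law (b : nat -> R) : Prop := {
  bl_nonneg : forall j : nat, j <> 1%nat -> 0 <= b j;
  bl_sum : is_series (fun j : nat => if Nat.eqb j 1 then 0 else b j) (- b 1%nat);
  bl_death : 0 < b 0%nat;
  bl_birth : 0 < Series (fun k : nat => b (k + 2)%nat)
}.

Definition B (b : nat -> R) (s : R) : R := PSeries b s.

(* The terms of m_b = sum_(j >= 2) (j - 1) b_j, with j = k + 2. *)
Definition mb_term (b : nat -> R) (k : nat) : R := INR (k + 1) * b (k + 2)%nat.

Definition m_b (b : nat -> R) : R := Series (mb_term b).

(* B'(1) < 0, where B'(1) = m_b - b_0 is a left derivative (B need not converge
   beyond 1).  [Series] being total, finiteness of m_b is required separately. *)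
Definition subcritical (b : nat -> R) : Prop :=
  ex_series (mb_term b) /\ m_b b < b 0%nat.

Definition D2 (b : nat -> R) : Rbar :=
  Lub_Rbar (fun x : R => exists s : R,
    0 < s < 1 /\ x = - ln s * RInt (fun r : R => / B b r) 0 s).

(* The condition j >= i - 1 is written i <= j + 1, because subtraction on [nat]
   is truncated. *)
Definition qmbp_q (b : nat -> R) (i j : nat) : R :=
  if Nat.leb i (j + 1) then INR i ^ 2 * b (j + 1 - i)%nat else 0.

Definition delta (i j : nat) : R := if Nat.eqb i j then 1 else 0.

(* Standard, possibly dishonest, transition functions on the state space [nat];
   the values of P at negative times are irrelevant. *)
Record transition_function (P : R -> nat -> nat -> R) : Prop := {
  tf_nonneg : forall (t : R) (i j : nat), 0 <= t -> 0 <= P t i j;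
  tf_summable : forall (t : R) (i : nat), 0 <= t -> ex_series (P t i);
  tf_mass : forall (t : R) (i : nat), 0 <= t -> Series (P t i) <= 1;
  tf_zero : forall i j : nat, P 0 i j = delta i j;
  tf_semigroup : forall (s t : R) (i j : nat), 0 <= s -> 0 <= t ->
    is_series (fun k : nat => P s i k * P t k j) (P (s + t) i j);
  tf_standard : forall i j : nat,
    filterlim (fun t : R => P t i j) (at_right 0) (locally (delta i j))
}.

Definition has_qmatrix (P : R -> nat -> nat -> R) (q : nat -> nat -> R) : Prop :=
  forall i j : nat,
    filterlim (fun t : R => (P t i j - delta i j) / t) (at_right 0)
      (locally (q i j)).

(* No minimality is imposed: when m_b <= b_0 this q-matrix has exactly one
   transition function, the Feller minimal one. *)
Definition qmbp_transition_function (b : nat -> R) (P : R -> nat -> nat -> R) : Prop :=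
  transition_function P /\ has_qmatrix P (qmbp_q b).

(* The decay parameter of the communicating class {1, 2, ...}. *)
Definition is_decay_parameter (P : R -> nat -> nat -> R) (lambda : R) : Prop :=
  forall i j : nat, (1 <= i)%nat -> (1 <= j)%nat ->
    is_lim (fun t : R => - (/ t * ln (P t i j))) p_infty lambda.

(* Main.v *)
Require Import Defs.
From Stdlib Require Import Reals Lra Lia Classical.
From Coquelicot Require Import Coquelicot.
Open Scope R_scope.

(** The bounds on [D2] come from comparing [B] with two linear functions: as [B] is a
    power series vanishing at 1 whose only negative coefficient is [b 1], replacing [s ^ n] by
    its chord or by its tangent at 1 gives
    [(b 0 - m_b b) (1 - s) <= B b s <= b 0 (1 - s)] on [0, 1).  Hence [- ln s] times the
    integral lies between [ln s * ln (1 - s) / b 0] and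
    [ln s * ln (1 - s) / (b 0 - m_b b)], and [ln s * ln (1 - s)] is largest at
    [s = 1/2].

    The decay parameter in fact satisfies the sharper bounds
    [b 0 - m_b b <= lambda <= b 0], which suffice because [1/2 < ln 2 < 1].  No spectral
    argument is involved.

    - Existence is Fekete's lemma for [- ln (P t 1 1)]; irreducibility transfers the rate
      from the pair (1, 1) to every other pair ([decay_parameter_exists]).

    - Everything else rests on a comparison principle ([comparison]): a bounded function of
      state and time that is propagated by the transition function stays below any
      nonnegative supersolution of the backward equation which dominates it at time 0.  It
      uses the conservative q-matrix only through the expansion of [P h i k] for small
      [h], and it excludes explosion through the Lyapunov function [k], whose drift
      [k^2 (m_b - b 0)] is negative.

    - Lower bound: the bounded concave function [k / (k + 1)] is contracted by the generator
      at rate [b 0 - m_b b], because the quadratic speed [i ^ 2] compensates the flatness of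
      the function at infinity.  Comparison gives
      [P t 1 1 <= 1 - P t 1 0 <= exp (- (b 0 - m_b b) t)].

    - Upper bound: the absorbing state 0 is entered only from 1, at rate [b 0], so the right
      derivative of [P t 1 0] is at most [b 0 * P t 1 1].  This forward inequality is not
      automatic for an infinite state space; it holds because comparison gives the uniform
      bound [P h k 0 <= b 0 * h] for [k >= 1], which allows limits to be taken under the sum.
      Supermultiplicativity gives [P t 1 1 <= exp (- lambda t)], and integrating over all
      times, with [P t 1 0] growing from 0 to 1, yields [1 <= b 0 / lambda]. *)

(** * Real series *)

(** Restates at type [R] an equality whose type is the carrier of an algebraic structure,
    so that [ring] and [field] recognise it. *)
Ltac real_equation := match goal with |- ?x = ?y => change (x = y :> R) end.

Lemma is_series_lim (a : nat -> R) (l : R) :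
  is_series a l <-> is_lim_seq (sum_n a) l.
Proof. split; exact (fun H => H). Qed.

Lemma is_series_le (a c : nat -> R) (la lc : R) :
  (forall n, a n <= c n) -> is_series a la -> is_series c lc -> la <= lc.
Proof.
  intros H Ha Hc.
  exact (is_lim_seq_le (sum_n a) (sum_n c) la lc
           (fun n => sum_n_m_le _ _ _ _ H) Ha Hc).
Qed.

Lemma is_series_lincomb (a c : nat -> R) (x y la lc : R) :
  is_series a la -> is_series c lc ->
  is_series (fun n => x * a n + y * c n) (x * la + y * lc).
Proof.
  intros Ha Hc.
  exact (is_series_plus _ _ _ _ (is_series_scal x _ _ Ha) (is_series_scal y _ _ Hc)).
Qed.

Lemma sum_n_single (i : nat) (x : nat -> R) (n : nat) :
  sum_n (fun k => if Nat.eqb i k then x k else 0) n = if Nat.leb i n then x i else 0.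
Proof.
  induction n as [|n IH].
  - rewrite sum_O. destruct i; reflexivity.
  - rewrite sum_Sn, IH. unfold plus; simpl plus.
    destruct (Nat.eqb_spec i (S n)), (Nat.leb_spec i n), (Nat.leb_spec i (S n));
      try lia; subst; simpl; lra.
Qed.

Lemma is_series_single (i : nat) (x : nat -> R) :
  is_series (fun k => if Nat.eqb i k then x k else 0) (x i).
Proof.
  apply is_series_lim. apply is_lim_seq_ext_loc with (fun _ => x i).
  - exists i. intros n Hn. rewrite sum_n_single.
    destruct (Nat.leb_spec i n); [reflexivity | lia].
  - apply is_lim_seq_const.
Qed.

Lemma sum_n_le_series (a : nat -> R) (l : R) (N : nat) :
  is_series a l -> (forall n, (N < n)%nat -> 0 <= a n) -> sum_n a N <= l.
Proof.
  intros Ha Hpos.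
  assert (H : forall n, sum_n a N <= sum_n a (N + n)).
  { induction n as [|n IH].
    - rewrite Nat.add_0_r. lra.
    - rewrite Nat.add_succ_r, sum_Sn. unfold plus; simpl plus.
      assert (0 <= a (S (N + n))) by (apply Hpos; lia). simpl. lra. }
  exact (is_lim_seq_le_loc (fun _ => sum_n a N) (sum_n a) _ l
    ltac:(exists N; intros n Hn; replace n with (N + (n - N))%nat by lia; apply H)
    (is_lim_seq_const _) Ha).
Qed.

Lemma term_le_series (a : nat -> R) (l : R) (i : nat) :
  (forall n, 0 <= a n) -> is_series a l -> a i <= l.
Proof.
  intros Hpos Ha.
  refine (is_series_le _ _ _ _ _ (is_series_single i a) Ha).
  intro n. cbv beta. destruct (Nat.eqb i n); [lra | apply Hpos].
Qed.

(** * The generating function of the offspring law *)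

Section Law.
Variable b : nat -> R.
Hypothesis Hb : branching_law b.

Lemma law_series : is_series b 0.
Proof.
  replace 0 with (1 * - b 1%nat + 1 * b 1%nat) by ring.
  eapply is_series_ext;
    [ | exact (is_series_lincomb _ _ 1 1 _ _ (bl_sum b Hb) (is_series_single 1 b))].
  intro n. cbv beta.
  destruct (Nat.eqb_spec n 1), (Nat.eqb_spec 1 n); subst; try lia; lra.
Qed.

Lemma law_b1_neg : b 1%nat < 0.
Proof.
  pose proof (bl_death b Hb) as H0.
  assert (H : b 0%nat <= - b 1%nat); [ | lra].
  refine (term_le_series (fun j => if Nat.eqb j 1 then 0 else b j) _ 0%nat _ (bl_sum b Hb)).
  intro n. cbv beta.
  destruct (Nat.eqb_spec n 1); [lra | now apply (bl_nonneg b Hb)].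
Qed.

Lemma law_abs_summable : ex_series (fun n => Rabs (b n)).
Proof.
  exists (1 * - b 1%nat + -1 * b 1%nat).
  eapply is_series_ext;
    [ | exact (is_series_lincomb _ _ 1 (-1) _ _ (bl_sum b Hb) (is_series_single 1 b))].
  intro n. cbv beta. pose proof law_b1_neg.
  destruct (Nat.eqb_spec n 1), (Nat.eqb_spec 1 n); subst; try lia.
  - rewrite Rabs_left by lra. lra.
  - rewrite Rabs_pos_eq by now apply (bl_nonneg b Hb). lra.
Qed.

Lemma law_B_series (s : R) : 0 <= s < 1 -> is_series (fun n => b n * s ^ n) (B b s).
Proof.
  intros Hs. apply is_pseries_R, PSeries_correct, ex_pseries_R.
  apply (ex_series_le (K := R_AbsRing) (V := R_CompleteNormedModule) _
           (fun n => Rabs (b n))); [ | apply law_abs_summable].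
  intro n. change (Rabs (b n * s ^ n) <= Rabs (b n)).
  rewrite Rabs_mult. rewrite <- (Rmult_1_r (Rabs (b n))) at 2.
  apply Rmult_le_compat_l; [apply Rabs_pos | ].
  rewrite Rabs_pos_eq by (apply pow_le; lra).
  rewrite <- (pow1 n). apply pow_incr. lra.
Qed.

Lemma law_B_continuous (s : R) : 0 <= s < 1 -> continuity_pt (B b) s.
Proof.
  intros Hs. apply PSeries_continuity.
  apply Rbar_lt_le_trans with 1.
  - simpl. rewrite Rabs_pos_eq; lra.
  - apply (CV_radius_bounded b). destruct law_abs_summable as [M HM].
    exists M. intro n. rewrite pow1, Rmult_1_r.
    exact (term_le_series _ _ n (fun k => Rabs_pos _) HM).
Qed.

(** Termwise comparison: for [n >= 1] the power [s ^ n] lies below its chord [s]; the term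
    [n = 0] contributes the excess [b 0 (1 - s)]. *)
Lemma law_B_le (s : R) : 0 <= s < 1 -> B b s <= b 0%nat * (1 - s).
Proof.
  intros Hs.
  replace (b 0%nat * (1 - s)) with (s * 0 + (1 - s) * b 0%nat) by ring.
  refine (is_series_le _ _ _ _ _ (law_B_series s Hs)
    (is_series_lincomb _ _ s (1 - s) _ _ law_series (is_series_single 0 b))).
  intros [|[|n]]; simpl Nat.eqb; cbv iota; try (simpl; lra).
  assert (0 <= b (S (S n))) by (apply (bl_nonneg b Hb); lia).
  assert (s ^ S (S n) <= s).
  { rewrite <- tech_pow_Rmult. rewrite <- (Rmult_1_r s) at 3.
    apply Rmult_le_compat_l; [lra | ].
    rewrite <- (pow1 (S n)). apply pow_incr. lra. }
  nra.
Qed.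

Hypothesis Hsub : subcritical b.

(** The drift of the chain at [i], up to its speed [i ^ 2]: the series is [B'(1) - B(1)]. *)
Lemma law_drift : is_series (fun n => (INR n - 1) * b n) (m_b b - b 0%nat).
Proof.
  apply (is_series_decr_n _ 2); [lia | ].
  assert (E : plus (m_b b - b 0%nat) (opp (sum_n (fun n => (INR n - 1) * b n) 1))
              = m_b b :> R).
  { rewrite sum_Sn, sum_O. unfold plus, opp; simpl. ring. }
  refine (eq_ind (m_b b) (is_series _) _ _ (eq_sym E)).
  apply is_series_ext with (mb_term b).
  - intro n. unfold mb_term. replace (n + 2)%nat with (2 + n)%nat by lia.
    rewrite !plus_INR. simpl (INR 2). simpl (INR 1).
    real_equation. ring.
  - apply Series_correct, Hsub.
Qed.

(** Termwise comparison: [s ^ n] lies above its tangent [1 - n (1 - s)] at 1. *)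
Lemma law_B_ge (s : R) : 0 <= s < 1 -> (b 0%nat - m_b b) * (1 - s) <= B b s.
Proof.
  intros Hs.
  replace ((b 0%nat - m_b b) * (1 - s))
    with (s * 0 + - (1 - s) * (m_b b - b 0%nat)) by ring.
  refine (is_series_le _ _ _ _ _
    (is_series_lincomb _ _ s (- (1 - s)) _ _ law_series law_drift) (law_B_series s Hs)).
  assert (Htan : forall n, 1 - INR n * (1 - s) <= s ^ n).
  { induction n as [|n IH]; [simpl; lra | ].
    rewrite S_INR, <- tech_pow_Rmult. pose proof (pos_INR n).
    assert (0 <= s * (s ^ n - (1 - INR n * (1 - s)))) by (apply Rmult_le_pos; lra).
    assert (0 <= INR n * (1 - s) ^ 2) by (apply Rmult_le_pos; [lra | apply pow2_ge_0]).
    nra. }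
  intros [|[|n]]; try (simpl; lra).
  assert (0 <= b (S (S n))) by (apply (bl_nonneg b Hb); lia).
  specialize (Htan (S (S n))). rewrite !S_INR in *. nra.
Qed.


(** * Bounds on the supremum *)

Lemma law_B_pos (s : R) : 0 <= s < 1 -> 0 < B b s.
Proof.
  intros Hs. pose proof (law_B_ge s Hs). destruct Hsub as [_ Hm].
  assert (0 < (b 0%nat - m_b b) * (1 - s)) by (apply Rmult_lt_0_compat; lra). lra.
Qed.

Lemma is_RInt_inv_affine (c s : R) : 0 < c -> 0 <= s < 1 ->
  is_RInt (fun r => / (c * (1 - r))) 0 s (- ln (1 - s) / c).
Proof.
  intros Hc Hs.
  replace (- ln (1 - s) / c) with (minus (- ln (1 - s) / c) (- ln (1 - 0) / c)).
  2:{ rewrite Rminus_0_r, ln_1. unfold minus, plus, opp; simpl. field. lra. }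
  apply (is_RInt_derive (fun r => - ln (1 - r) / c)).
  - intros x Hx. rewrite Rmin_left, Rmax_right in Hx by lra.
    auto_derive; [lra | field; lra].
  - intros x Hx. rewrite Rmin_left, Rmax_right in Hx by lra.
    apply (ex_derive_continuous (K := R_AbsRing) (V := R_NormedModule)).
    auto_derive. assert (0 < c * (1 - x)) by (apply Rmult_lt_0_compat; lra). lra.
Qed.

Lemma RInt_inv_B_bounds (s : R) : 0 <= s < 1 ->
  - ln (1 - s) / b 0%nat <= RInt (fun r => / B b r) 0 s
    <= - ln (1 - s) / (b 0%nat - m_b b).
Proof.
  intros Hs. pose proof (bl_death b Hb) as H0. destruct Hsub as [_ Hm].
  assert (Hex : ex_RInt (fun r => / B b r) 0 s).
  { apply (ex_RInt_continuous (V := R_CompleteNormedModule)).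
    intros z Hz. rewrite Rmin_left, Rmax_right in Hz by lra.
    apply continuity_pt_filterlim, continuity_pt_inv.
    - apply law_B_continuous. lra.
    - pose proof (law_B_pos z). lra. }
  assert (Hi : forall c, 0 < c -> is_RInt (fun r => / (c * (1 - r))) 0 s (- ln (1 - s) / c))
    by (intros; apply is_RInt_inv_affine; lra).
  split.
  - rewrite <- (is_RInt_unique _ _ _ _ (Hi (b 0%nat) H0)).
    apply RInt_le; [lra | eexists; apply Hi; lra | exact Hex | ].
    intros x Hx. apply Rinv_le_contravar; [apply law_B_pos | apply law_B_le]; lra.
  - rewrite <- (is_RInt_unique _ _ _ _ (Hi (b 0%nat - m_b b) ltac:(lra))).
    apply RInt_le; [lra | exact Hex | eexists; apply Hi; lra | ].
    intros x Hx. apply Rinv_le_contravar; [ | apply law_B_ge; lra].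
    apply Rmult_lt_0_compat; lra.
Qed.
End Law.

(** The sign of the derivative of [ln s * ln (1 - s)].  Both sides tend to 0 at 0, so a
    convexity argument on the whole interval would need a limit there.  Below [1/e] the
    elementary bounds [ln s <= -1] and [- s <= (1 - s) ln (1 - s)] suffice; above it the
    difference decreases to its value 0 at [1/2]. *)
Lemma xlogx_le_compl (s : R) : 0 < s <= 1 / 2 -> s * ln s <= (1 - s) * ln (1 - s).
Proof.
  intros Hs. pose proof (exp_ineq1 1 ltac:(lra)) as He.
  destruct (Rle_lt_dec s (exp (-1))) as [Hle | Hgt].
  - assert (ln s <= -1) by (rewrite <- (ln_exp (-1)); apply ln_le; lra).
    assert (- s <= (1 - s) * ln (1 - s)).
    { assert (H0 := exp_ineq1_le (- ln (1 - s))).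
      rewrite exp_Ropp, exp_ln in H0 by lra.
      assert ((1 - s) * (1 + - ln (1 - s)) <= (1 - s) * / (1 - s))
        by (apply Rmult_le_compat_l; lra).
      rewrite Rinv_r in H1 by lra. lra. }
    nra.
  - destruct (MVT_gen (fun x => (1 - x) * ln (1 - x) - x * ln x) s (1 / 2)
      (fun x => - ln (x * (1 - x)) - 2)) as [x [Hx Heq]].
    + intros x Hx. rewrite Rmin_left, Rmax_right in Hx by lra.
      auto_derive; [lra | ]. rewrite ln_mult by lra. unfold Rminus. field. lra.
    + intros x Hx. rewrite Rmin_left, Rmax_right in Hx by lra.
      apply derivable_continuous_pt, ex_derive_Reals_0. auto_derive. lra.
    + rewrite Rmin_left, Rmax_right in Hx by lra.
      replace (1 - 1 / 2) with (1 / 2) in Heq by field.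
      (* [x (1 - x) >= exp (-1) / 2 >= exp (-2)] *)
      assert (-2 <= ln (x * (1 - x))).
      { rewrite <- (ln_exp (-2)). apply ln_le; [apply exp_pos | ].
        replace (-2) with (-1 + -1) by ring. rewrite exp_plus.
        assert (exp (-1) <= 1 / 2).
        { replace (exp (-1)) with (/ exp 1) by (rewrite <- exp_Ropp; f_equal; ring).
          replace (1 / 2) with (/ 2) by field.
          apply Rinv_le_contravar; lra. }
        pose proof (exp_pos (-1)). nra. }
      nra.
Qed.

Lemma log_product_le_half (s : R) : 0 < s <= 1 / 2 -> ln s * ln (1 - s) <= ln 2 ^ 2.
Proof.
  intros Hs.
  destruct (MVT_gen (fun x => ln x * ln (1 - x)) s (1 / 2)
      (fun x => ((1 - x) * ln (1 - x) - x * ln x) / (x * (1 - x)))) as [x [Hx Heq]].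
  - intros x Hx. rewrite Rmin_left, Rmax_right in Hx by lra.
    auto_derive; [lra | unfold Rminus; field; lra].
  - intros x Hx. rewrite Rmin_left, Rmax_right in Hx by lra.
    apply derivable_continuous_pt, ex_derive_Reals_0. auto_derive. lra.
  - rewrite Rmin_left, Rmax_right in Hx by lra.
    assert (Hhalf : ln (1 / 2) = - ln 2)
      by (unfold Rdiv; rewrite Rmult_1_l; apply ln_Rinv; lra).
    replace (1 - 1 / 2) with (1 / 2) in Heq by field.
    rewrite Hhalf in Heq.
    assert (0 <= ((1 - x) * ln (1 - x) - x * ln x) / (x * (1 - x))).
    { apply Rdiv_le_0_compat; [pose proof (xlogx_le_compl x); lra | nra]. }
    nra.
Qed.

Lemma log_product_le (s : R) : 0 < s < 1 -> ln s * ln (1 - s) <= ln 2 ^ 2.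
Proof.
  intros Hs. destruct (Rle_lt_dec s (1 / 2)).
  - apply log_product_le_half. lra.
  - pose proof (log_product_le_half (1 - s) ltac:(lra)) as H.
    replace (1 - (1 - s)) with s in H by ring. lra.
Qed.

Lemma D2_bounds (b : nat -> R) : branching_law b -> subcritical b ->
  Rbar_le (Finite (ln 2 ^ 2 / b 0%nat)) (D2 b) /\
  Rbar_le (D2 b) (Finite (ln 2 ^ 2 / (b 0%nat - m_b b))).
Proof.
  intros Hb Hsub. pose proof (bl_death b Hb) as H0. pose proof (proj2 Hsub) as Hm.
  unfold D2. destruct (Lub_Rbar_correct (fun x => exists s : R,
    0 < s < 1 /\ x = - ln s * RInt (fun r : R => / B b r) 0 s)) as [Hub Hleast].
  split.
  - eapply Rbar_le_trans; [ | apply Hub; exists (1 / 2); split; [lra | reflexivity]].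
    cbn [Rbar_le]. pose proof (proj1 (RInt_inv_B_bounds b Hb Hsub (1 / 2) ltac:(lra))) as H.
    replace (1 - 1 / 2) with (/ 2) in H by field. rewrite ln_Rinv in H by lra.
    replace (1 / 2) with (/ 2) in * by field. rewrite ln_Rinv by lra.
    pose proof ln_lt_2. rewrite !Ropp_involutive in *.
    replace (ln 2 ^ 2 / b 0%nat) with (ln 2 * (ln 2 / b 0%nat)) by (field; lra).
    apply Rmult_le_compat_l; lra.
  - apply Hleast. intros x [s [Hs ->]]. cbn [Rbar_le].
    pose proof (proj2 (RInt_inv_B_bounds b Hb Hsub s ltac:(lra))) as H.
    assert (ln s < 0) by (rewrite <- ln_1; apply ln_increasing; lra).
    apply Rle_trans with (- ln s * (- ln (1 - s) / (b 0%nat - m_b b))).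
    + apply Rmult_le_compat_l; lra.
    + replace (- ln s * (- ln (1 - s) / (b 0%nat - m_b b)))
        with ((ln s * ln (1 - s)) / (b 0%nat - m_b b)) by (field; lra).
      apply Rmult_le_compat_r; [ | now apply log_product_le].
      left. apply Rinv_0_lt_compat. lra.
Qed.

(** * Right limits *)

Lemma at_right_intro (P : R -> Prop) (x d : R) :
  0 < d -> (forall y, x < y < x + d -> P y) -> at_right x P.
Proof.
  intros Hd H. exists (mkposreal d Hd). intros y Hy Hlt. apply H.
  change (Rabs (y - x) < d) in Hy. rewrite Rabs_pos_eq in Hy by lra. lra.
Qed.

Lemma at_right_elim (P : R -> Prop) (x : R) :
  at_right x P -> exists d, 0 < d /\ forall y, x < y < x + d -> P y.
Proof.
  intros [d H]. exists d. split; [apply cond_pos | ].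
  intros y Hy. apply H; [ | lra].
  change (Rabs (y - x) < d). rewrite Rabs_pos_eq by lra. lra.
Qed.

Lemma right_lim_sum (f : nat -> R -> R) (l : nat -> R) (K : nat) :
  (forall k, (k <= K)%nat -> filterlim (f k) (at_right 0) (locally (l k))) ->
  filterlim (fun h => sum_n (fun k => f k h) K) (at_right 0) (locally (sum_n l K)).
Proof.
  induction K as [|K IH]; intros H.
  - rewrite sum_O. eapply filterlim_ext; [ | exact (H 0%nat (le_n _))].
    intro h. now rewrite sum_O.
  - rewrite sum_Sn.
    eapply filterlim_ext; [intro h; symmetry; apply sum_Sn | ].
    exact (filterlim_comp_2 _ _ _ (IH (fun k Hk => H k (le_S _ _ Hk))) (H (S K) (le_n _))
             (filterlim_plus (V := R_NormedModule) (sum_n l K) (l (S K)))).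
Qed.

Lemma right_lim_mult (f g : R -> R) (x l m : R) :
  filterlim f (at_right x) (locally l) -> filterlim g (at_right x) (locally m) ->
  filterlim (fun h => f h * g h) (at_right x) (locally (l * m)).
Proof.
  intros Hf Hg.
  exact (filterlim_comp_2 _ _ _ Hf Hg (filterlim_mult (K := R_AbsRing) l m)).
Qed.

Lemma right_lim_plus (f g : R -> R) (x l m : R) :
  filterlim f (at_right x) (locally l) -> filterlim g (at_right x) (locally m) ->
  filterlim (fun h => f h + g h) (at_right x) (locally (l + m)).
Proof.
  intros Hf Hg.
  exact (filterlim_comp_2 _ _ _ Hf Hg (filterlim_plus (V := R_NormedModule) l m)).
Qed.

Lemma right_lim_ge0 (f : R -> R) (x l : R) :
  at_right x (fun h => 0 <= f h) -> filterlim f (at_right x) (locally l) -> 0 <= l.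
Proof.
  intros Hf Hl.
  exact (filterlim_le (F := at_right x) (fun _ => 0) f 0 l Hf (filterlim_const _) Hl).
Qed.

Lemma continuous_right_lim (g : R -> R) (x : R) :
  continuous g x -> filterlim g (at_right x) (locally (g x)).
Proof.
  intros H A HA. destruct (H A HA) as [d Hd]. exists d. intros y Hy _. now apply Hd.
Qed.

Lemma derive_right_lim (g : R -> R) (l : R) :
  is_derive g 0 l -> filterlim (fun h => (g h - g 0) / h) (at_right 0) (locally l).
Proof.
  intros H. apply is_derive_Reals in H.
  apply filterlim_locally. intro eps.
  destruct (H eps (cond_pos eps)) as [d Hd].
  apply at_right_intro with d; [apply cond_pos | ].
  intros h Hh. specialize (Hd h). rewrite Rplus_0_l in Hd.
  apply Hd; [lra | rewrite Rabs_pos_eq; lra].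
Qed.

(** * A comparison principle *)

Lemma finite_family_max (phi : nat -> R -> R) (T : R) (N : nat) :
  0 <= T -> (forall k t, continuity_pt (phi k) t) ->
  exists i t, (i <= N)%nat /\ 0 <= t <= T /\
    forall k s, (k <= N)%nat -> 0 <= s <= T -> phi k s <= phi i t.
Proof.
  intros HT Hc.
  assert (Hone : forall k, exists t, 0 <= t <= T /\
                  forall s, 0 <= s <= T -> phi k s <= phi k t).
  { intro k. destruct (continuity_ab_maj (phi k) 0 T HT (fun s _ => Hc k s))
      as [t [H1 H2]]. now exists t. }
  induction N as [|N (i & t & Hi & Ht & Hmax)].
  - destruct (Hone 0%nat) as (t & Ht & Hmax). exists 0%nat, t.
    refine (conj _ (conj Ht _)); [lia | ].
    intros k s Hk Hs. replace k with 0%nat by lia. now apply Hmax.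
  - destruct (Hone (S N)) as (t' & Ht' & Hmax').
    destruct (Rle_lt_dec (phi (S N) t') (phi i t)).
    + exists i, t. refine (conj _ (conj Ht _)); [lia | ]. intros k s Hk Hs.
      destruct (Nat.eq_dec k (S N)) as [-> | ]; [ | apply Hmax; [lia | assumption]].
      specialize (Hmax' s Hs). lra.
    + exists (S N), t'. refine (conj _ (conj Ht' _)); [lia | ]. intros k s Hk Hs.
      destruct (Nat.eq_dec k (S N)) as [-> | ]; [now apply Hmax' | ].
      specialize (Hmax k s ltac:(lia) Hs). lra.
Qed.

(** The hypothesis on [u] is a step inequality: over a short time [h], the
    value at [i] is at most its mean over [P h i], with the terms outside the window
    [0 .. K] and the mass that is lost both given the largest value 1.  Such a form holds for
    [P t k j] and for [1 - P t k j] alike, and it involves only finitely many entries of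
    [P h i], so that the q-matrix may be inserted entry by entry.  [V] forces the relevant
    states into a finite set. *)
Section Comparison.
Variable P : R -> nat -> nat -> R.
Variable q : nat -> nat -> R.
Hypothesis HPpos : forall t i j, 0 <= t -> 0 <= P t i j.
Hypothesis Hq : has_qmatrix P q.
Hypothesis Hcons : forall i, is_series (q i) 0.

Variable V : nat -> R.
Hypothesis HVpos : forall k, 0 <= V k.
Hypothesis HVinf : forall M, exists N, forall k, (N < k)%nat -> M < V k.
Hypothesis HV : forall i, exists l, l <= 0 /\ is_series (fun k => q i k * V k) l.

Variable u : nat -> R -> R.
Hypothesis Hucont : forall k t, continuity_pt (u k) t.
Hypothesis Hu1 : forall k t, u k t <= 1.
Hypothesis Hustep : forall K i s h, 0 <= s -> 0 <= h ->
  u i (s + h) <= 1 + sum_n (fun k => P h i k * (u k s - 1)) K.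

Variables w dw : nat -> R -> R.
Hypothesis Hwder : forall k t, is_derive (w k) t (dw k t).
Hypothesis Hwpos : forall k t, 0 <= t -> 0 <= w k t.
Hypothesis Hw0 : forall k, u k 0 <= w k 0.
Hypothesis Hwsuper : forall i t, 0 <= t ->
  exists l, l <= dw i t /\ is_series (fun k => q i k * w k t) l.

Section Margin.
Variable eps : R.
Hypothesis Heps : 0 < eps.

(* The term in [V] makes [psi k] exceed 1 for large [k]; the term in [t] makes the
   supersolution strict. *)
Let psi k t := w k t + eps * (V k + t).

Lemma margin_derive k t : is_derive (psi k) t (dw k t + eps).
Proof.
  unfold psi. apply (is_derive_plus (K := R_AbsRing) (V := R_NormedModule)); [apply Hwder | ].
  auto_derive; [exact I | ring].
Qed.

Lemma margin_continuous k t : continuous (psi k) t.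
Proof.
  apply (ex_derive_continuous (K := R_AbsRing) (V := R_NormedModule)).
  eexists. apply margin_derive.
Qed.

(** At a contact point, looking back over a time [h] gives a nonnegative quantity which
    vanishes at [h = 0]; the conclusion is the limit of its quotient by [h]. *)
Lemma contact_inequality (M t0 : R) (i : nat) :
  0 < t0 -> u i t0 = M + psi i t0 ->
  (forall k s, 0 <= s <= t0 -> u k s <= M + psi k s) ->
  forall K, (i <= K)%nat ->
  0 <= sum_n (fun k => q i k * (M + psi k t0 - 1)) K - (dw i t0 + eps).
Proof.
  intros Ht0 Htouch Hbelow K HK.
  apply right_lim_ge0 with (x := 0) (f := fun h =>
    sum_n (fun k => (P h i k - delta i k) / h * (M + psi k (t0 - h) - 1)) K
    + (psi i (t0 - h) - psi i (t0 - 0)) / h).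
  - apply at_right_intro with t0; [assumption | ]. intros h Hh.
    assert (Hstep := Hustep K i (t0 - h) h ltac:(lra) ltac:(lra)).
    replace (t0 - h + h) with t0 in Hstep by ring. rewrite Htouch in Hstep.
    assert (Hle : sum_n (fun k => P h i k * (u k (t0 - h) - 1)) K
               <= sum_n (fun k => P h i k * (M + psi k (t0 - h) - 1)) K).
    { apply sum_n_m_le. intro k. apply Rmult_le_compat_l; [apply HPpos; lra | ].
      specialize (Hbelow k (t0 - h) ltac:(lra)). lra. }
    assert (Heq : sum_n (fun k => (P h i k - delta i k) / h * (M + psi k (t0 - h) - 1)) K
      = / h * (sum_n (fun k => P h i k * (M + psi k (t0 - h) - 1)) K
               - (M + psi i (t0 - h) - 1))).
    { replace (M + psi i (t0 - h) - 1) with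
        (sum_n (fun k => if Nat.eqb i k then M + psi k (t0 - h) - 1 else 0) K)
        by (rewrite sum_n_single; destruct (Nat.leb_spec i K); [reflexivity | lia]).
      rewrite !sum_n_Reals, <- minus_sum, scal_sum. apply sum_eq. intros k _.
      unfold delta. destruct (Nat.eqb i k); field; lra. }
    rewrite Heq, Rminus_0_r.
    replace (_ + _) with (/ h * (1 + sum_n (fun k => P h i k * (M + psi k (t0 - h) - 1)) K
       - (M + psi i t0))) by (field; lra).
    apply Rmult_le_pos; [left; apply Rinv_0_lt_compat; lra | lra].
  - apply right_lim_plus.
    + apply (right_lim_sum (fun k h => (P h i k - delta i k) / h * (M + psi k (t0 - h) - 1))
        (fun k => q i k * (M + psi k t0 - 1))).
      intros k _. apply right_lim_mult; [apply Hq | ].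
      replace (M + psi k t0 - 1) with (M + psi k (t0 - 0) - 1) by (now rewrite Rminus_0_r).
      apply (continuous_right_lim (fun h => M + psi k (t0 - h) - 1)).
      apply (continuous_comp (fun h => t0 - h) (fun x => M + psi k x - 1)).
      * apply (ex_derive_continuous (K := R_AbsRing) (V := R_NormedModule)).
        auto_derive. exact I.
      * apply (ex_derive_continuous (K := R_AbsRing) (V := R_NormedModule)).
        pose proof (margin_derive k (t0 - 0)) as Hd. eexists.
        apply (is_derive_minus (K := R_AbsRing) (V := R_NormedModule)); [ | apply is_derive_const].
        apply (is_derive_plus (K := R_AbsRing) (V := R_NormedModule));
          [apply is_derive_const | apply Hd].
    + apply (derive_right_lim (fun h => psi i (t0 - h))).
      replace (- (dw i t0 + eps)) with (scal (-1) (dw i t0 + eps))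
        by (change (-1 * (dw i t0 + eps) = - (dw i t0 + eps)); ring).
      apply (is_derive_comp (K := R_AbsRing) (V := R_NormedModule)).
      * rewrite Rminus_0_r. apply margin_derive.
      * auto_derive; [exact I | ring].
Qed.

(** A positive maximum [M] of [u - psi] is attained among finitely many states.  As [q] is
    conservative, letting the window grow in the contact inequality removes [M] and leaves
    [dw + eps <= Qw + eps QV <= dw]. *)
Lemma comparison_margin j T : 0 <= T -> u j T <= psi j T.
Proof.
  intros HT. destruct (Rle_lt_dec (u j T) (psi j T)) as [ | Hbad]; [assumption | exfalso].
  destruct (HVinf (/ eps)) as [N0 HN0].
  set (phi := fun k t => u k t - psi k t).
  assert (Hphic : forall k t, continuity_pt (phi k) t).
  { intros k t. apply continuity_pt_minus; [apply Hucont | ].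
    apply continuity_pt_filterlim, margin_continuous. }
  destruct (finite_family_max phi T (Nat.max N0 j) HT Hphic) as (i & t0 & Hi & Ht0 & Hmax).
  set (M := phi i t0) in *.
  assert (HM : 0 < M).
  { assert (phi j T <= M) by (apply Hmax; [lia | lra]). unfold phi in *. lra. }
  assert (Hbelow : forall k s, 0 <= s <= T -> u k s <= M + psi k s).
  { intros k s Hs. destruct (Nat.le_gt_cases k (Nat.max N0 j)) as [Hk | Hk].
    - specialize (Hmax k s Hk Hs). unfold phi in *. lra.
    - specialize (HN0 k ltac:(lia)). specialize (Hu1 k s). specialize (Hwpos k s ltac:(lra)).
      assert (1 < eps * V k).
      { rewrite <- (Rinv_r eps) by lra. apply Rmult_lt_compat_l; lra. }
      unfold psi. nra. }
  assert (Hpos : 0 < t0).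
  { destruct (Rle_lt_or_eq_dec 0 t0 (proj1 Ht0)) as [ | <-]; [assumption | exfalso].
    unfold M, phi, psi in HM. specialize (Hw0 i). specialize (HVpos i). nra. }
  destruct (Hwsuper i t0 ltac:(lra)) as (lw & Hlw & Hsw).
  destruct (HV i) as (lv & Hlv & Hsv).
  assert (Hlim : is_series (fun k => q i k * (M + psi k t0 - 1)) (lw + eps * lv)).
  { replace (lw + eps * lv) with (1 * (1 * lw + eps * lv) + (M - 1 + eps * t0) * 0) by ring.
    eapply is_series_ext;
      [ | exact (is_series_lincomb _ _ _ _ _ _
              (is_series_lincomb _ _ 1 eps _ _ Hsw Hsv) (Hcons i))].
    intro k. unfold psi. real_equation. ring. }
  assert (dw i t0 + eps <= lw + eps * lv).
  { refine (is_lim_seq_le_loc (fun _ => dw i t0 + eps) _ (dw i t0 + eps) (lw + eps * lv)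
      _ (is_lim_seq_const _) Hlim).
    exists i. intros K HK.
    apply Rminus_le_0. exact (contact_inequality M t0 i Hpos ltac:(unfold M, phi; ring)
      ltac:(intros; apply Hbelow; lra) K HK). }
  nra.
Qed.
End Margin.

Lemma comparison j T : 0 <= T -> u j T <= w j T.
Proof.
  intros HT. apply Rnot_lt_le. intro Hbad.
  assert (Hd : 0 < V j + T + 1) by (pose proof (HVpos j); lra).
  set (eps := (u j T - w j T) / (2 * (V j + T + 1))).
  assert (Heps : 0 < eps) by (apply Rdiv_lt_0_compat; lra).
  pose proof (comparison_margin eps Heps j T HT) as Hle. cbv beta in Hle.
  assert (eps * (V j + T + 1) = (u j T - w j T) / 2) by (unfold eps; field; lra).
  lra.
Qed.
End Comparison.

(** * Transition functions *)

Lemma sum_n_neg (a c : nat -> R) (K : nat) :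
  (forall k, a k = - c k) -> sum_n a K = - sum_n c K.
Proof.
  intros H. induction K as [|K IH].
  - rewrite !sum_O. apply H.
  - rewrite !sum_Sn, IH, H. unfold plus; simpl. ring.
Qed.

Section Transition.
Variable P : R -> nat -> nat -> R.
Hypothesis HP : transition_function P.

Lemma tf_row (t : R) (i : nat) : 0 <= t -> is_series (P t i) (Series (P t i)).
Proof. intros Ht. apply Series_correct. now apply (tf_summable P HP). Qed.

Lemma tf_le1 (t : R) (i j : nat) : 0 <= t -> P t i j <= 1.
Proof.
  intros Ht. apply Rle_trans with (Series (P t i)); [ | now apply (tf_mass P HP)].
  apply (term_le_series (P t i) _ j); [ | now apply tf_row].
  intro k. now apply (tf_nonneg P HP).
Qed.

Lemma tf_path (s t : R) (i k j : nat) : 0 <= s -> 0 <= t ->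
  P s i k * P t k j <= P (s + t) i j.
Proof.
  intros Hs Ht.
  apply (term_le_series (fun k => P s i k * P t k j) _ k);
    [ | now apply (tf_semigroup P HP)].
  intro n. apply Rmult_le_pos; now apply (tf_nonneg P HP).
Qed.

Lemma tf_defect_series (s t : R) (i j : nat) : 0 <= s -> 0 <= t ->
  is_series (fun k => P s i k * (1 - P t k j)) (Series (P s i) - P (s + t) i j).
Proof.
  intros Hs Ht.
  replace (Series (P s i) - P (s + t) i j)
    with (1 * Series (P s i) + -1 * P (s + t) i j) by ring.
  eapply is_series_ext;
    [ | exact (is_series_lincomb _ _ 1 (-1) _ _ (tf_row s i Hs)
                (tf_semigroup P HP s t i j Hs Ht))].
  intro k. cbv beta. real_equation. ring.
Qed.

Lemma tf_defect_nonneg (s t : R) (i j k : nat) : 0 <= s -> 0 <= t ->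
  0 <= P s i k * (1 - P t k j).
Proof.
  intros Hs Ht. apply Rmult_le_pos; [now apply (tf_nonneg P HP) | ].
  pose proof (tf_le1 t k j Ht). lra.
Qed.

Lemma tf_step (K i j : nat) (s h : R) : 0 <= s -> 0 <= h ->
  P (s + h) i j <= 1 + sum_n (fun k => P h i k * (P s k j - 1)) K.
Proof.
  intros Hs Hh.
  assert (Hle := sum_n_le_series _ _ K (tf_defect_series h s i j Hh Hs)
     (fun k _ => tf_defect_nonneg h s i j k Hh Hs)).
  assert (Heq : sum_n (fun k => P h i k * (P s k j - 1)) K =
                - sum_n (fun k => P h i k * (1 - P s k j)) K).
  { apply sum_n_neg. intro k. ring. }
  rewrite Heq, (Rplus_comm s h). pose proof (tf_mass P HP h i Hh).
  apply Rle_trans with (1 - (Series (P h i) - P (h + s) i j)); [lra | ].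
  apply Rplus_le_compat_l, Ropp_le_contravar, Hle.
Qed.

Lemma tf_step_compl (K i j : nat) (s h : R) : 0 <= s -> 0 <= h ->
  1 - P (s + h) i j <= 1 + sum_n (fun k => P h i k * ((1 - P s k j) - 1)) K.
Proof.
  intros Hs Hh.
  assert (Hle := sum_n_le_series _ _ K (tf_semigroup P HP h s i j Hh Hs)
     (fun k _ => Rmult_le_pos _ _ (tf_nonneg P HP h i k Hh) (tf_nonneg P HP s k j Hs))).
  assert (Heq : sum_n (fun k => P h i k * ((1 - P s k j) - 1)) K =
                - sum_n (fun k => P h i k * P s k j) K).
  { apply sum_n_neg. intro k. ring. }
  rewrite Heq, (Rplus_comm s h).
  apply Rplus_le_compat_l, Ropp_le_contravar, Hle.
Qed.

(** The modulus does not depend on [s] or [j], which makes every entry uniformly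
    continuous in time. *)
Lemma tf_modulus (s h : R) (i j : nat) : 0 <= s -> 0 <= h ->
  Rabs (P (s + h) i j - P s i j) <= 1 - P h i i.
Proof.
  intros Hs Hh.
  pose proof (tf_path h s i i j Hh Hs) as Hlow.
  pose proof (term_le_series _ _ i (fun k => tf_defect_nonneg h s i j k Hh Hs)
    (tf_defect_series h s i j Hh Hs)) as Hup. cbv beta in Hup.
  pose proof (tf_mass P HP h i Hh). rewrite (Rplus_comm s h).
  pose proof (tf_nonneg P HP s i j Hs). pose proof (tf_le1 s i j Hs).
  pose proof (tf_le1 h i i Hh).
  apply Rabs_le. nra.
Qed.

Lemma tf_near_id (i : nat) (eps : R) : 0 < eps ->
  exists d, 0 < d /\ forall h, 0 <= h < d -> 1 - P h i i < eps.
Proof.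
  intros He.
  pose proof (proj1 (filterlim_locally _ _) (tf_standard P HP i i) (mkposreal eps He)) as Hn.
  apply at_right_elim in Hn. destruct Hn as [d [Hd Hball]]. exists d.
  split; [assumption | ]. intros h Hh.
  destruct (Rle_lt_or_eq_dec 0 h (proj1 Hh)) as [Hpos | <-].
  - specialize (Hball h ltac:(lra)). unfold delta in Hball. rewrite Nat.eqb_refl in Hball.
    change (Rabs (P h i i - 1) < eps) in Hball. apply Rabs_def2 in Hball. lra.
  - rewrite (tf_zero P HP). unfold delta. rewrite Nat.eqb_refl. lra.
Qed.

(** Composing with [Rabs] extends the entries continuously to negative times, as two-sided
    continuity at 0 requires. *)
Lemma tf_continuity (i j : nat) (t : R) : continuity_pt (fun s => P (Rabs s) i j) t.
Proof.
  apply continuity_pt_filterlim, filterlim_locally. intro eps.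
  destruct (tf_near_id i eps (cond_pos eps)) as [d [Hd Hid]].
  exists (mkposreal d Hd). intros s Hs. change (Rabs (s - t) < d) in Hs.
  change (Rabs (P (Rabs s) i j - P (Rabs t) i j) < eps).
  pose proof (Rabs_pos s). pose proof (Rabs_pos t).
  pose proof (Rabs_triang_inv2 s t) as Htri.
  destruct (Rle_lt_dec (Rabs t) (Rabs s)) as [Hle | Hlt].
  - rewrite (Rabs_pos_eq (Rabs s - Rabs t)) in Htri by lra.
    pose proof (tf_modulus (Rabs t) (Rabs s - Rabs t) i j ltac:(lra) ltac:(lra)) as Hm.
    replace (Rabs t + (Rabs s - Rabs t)) with (Rabs s) in Hm by ring.
    specialize (Hid (Rabs s - Rabs t) ltac:(lra)). lra.
  - rewrite (Rabs_left (Rabs s - Rabs t)) in Htri by lra.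
    pose proof (tf_modulus (Rabs s) (Rabs t - Rabs s) i j ltac:(lra) ltac:(lra)) as Hm.
    replace (Rabs s + (Rabs t - Rabs s)) with (Rabs t) in Hm by ring.
    rewrite Rabs_minus_sym in Hm.
    specialize (Hid (Rabs t - Rabs s) ltac:(lra)). lra.
Qed.

Lemma tf_diag_lower (i : nat) (T : R) :
  exists m, 0 < m /\ forall t, 0 <= t <= T -> m <= P t i i.
Proof.
  destruct (tf_near_id i (1 / 2) ltac:(lra)) as [d [Hd Hid]].
  assert (Hn : forall n t, 0 <= t <= INR n * (d / 2) -> (1 / 2) ^ n <= P t i i).
  { induction n as [|n IH]; intros t Ht.
    - simpl in *. replace t with 0 by lra. specialize (Hid 0 ltac:(lra)).
      rewrite (tf_zero P HP). unfold delta. rewrite Nat.eqb_refl. lra.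
    - assert (Hhalf : 0 <= (1 / 2) ^ n <= 1).
      { split; [apply pow_le; lra | ].
        apply Rle_trans with (1 ^ n); [apply pow_incr; lra | rewrite pow1; lra]. }
      rewrite <- tech_pow_Rmult. rewrite S_INR in Ht.
      destruct (Rle_lt_dec t (d / 2)) as [Hle | Hlt].
      + specialize (Hid t ltac:(lra)). lra.
      + specialize (IH (t - d / 2) ltac:(lra)). specialize (Hid (d / 2) ltac:(lra)).
        pose proof (tf_path (d / 2) (t - d / 2) i i i ltac:(lra) ltac:(lra)) as Hp.
        replace (d / 2 + (t - d / 2)) with t in Hp by ring.
        apply Rle_trans with (2 := Hp). apply Rmult_le_compat; lra. }
  destruct (INR_unbounded (T / (d / 2))) as [n HnT].
  exists ((1 / 2) ^ n). split; [apply pow_lt; lra | ]. intros t Ht. apply Hn.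
  split; [lra | ]. apply Rle_trans with T; [lra | ].
  apply (Rmult_le_reg_r (/ (d / 2))); [apply Rinv_0_lt_compat; lra | ].
  rewrite Rmult_assoc, Rinv_r by lra. unfold Rdiv at 1 in HnT. lra.
Qed.

Lemma tf_diag_pos (i : nat) (t : R) : 0 <= t -> 0 < P t i i.
Proof.
  intros Ht. destruct (tf_diag_lower i t) as [m [Hm Hle]].
  specialize (Hle t ltac:(lra)). lra.
Qed.

Definition reach (i j : nat) : Prop := forall t, 0 < t -> 0 < P t i j.

Lemma reach_refl (i : nat) : reach i i.
Proof. intros t Ht. apply tf_diag_pos. lra. Qed.

Lemma reach_trans (i j k : nat) : reach i j -> reach j k -> reach i k.
Proof.
  intros Hij Hjk t Ht.
  pose proof (tf_path (t / 2) (t / 2) i j k ltac:(lra) ltac:(lra)) as Hp.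
  replace (t / 2 + t / 2) with t in Hp by field.
  apply Rlt_le_trans with (2 := Hp). apply Rmult_lt_0_compat; [apply Hij | apply Hjk]; lra.
Qed.

Lemma reach_rate (q : nat -> nat -> R) (i j : nat) :
  has_qmatrix P q -> i <> j -> 0 < q i j -> reach i j.
Proof.
  intros Hq Hne Hpos t Ht.
  pose proof (proj1 (filterlim_locally _ _) (Hq i j) (mkposreal _ Hpos)) as Hn.
  apply at_right_elim in Hn. destruct Hn as [d [Hd Hball]].
  set (h := Rmin (d / 2) t).
  assert (Hh : 0 < h /\ h <= d / 2 /\ h <= t).
  { unfold h. repeat split; [apply Rmin_glb_lt; lra | apply Rmin_l | apply Rmin_r]. }
  specialize (Hball h ltac:(lra)).
  change (Rabs ((P h i j - delta i j) / h - q i j) < q i j) in Hball.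
  apply Rabs_def2 in Hball. unfold delta in Hball.
  destruct (Nat.eqb_spec i j); [contradiction | ]. rewrite Rminus_0_r in Hball.
  assert (0 < P h i j).
  { replace (P h i j) with (P h i j / h * h) by (field; lra).
    apply Rmult_lt_0_compat; lra. }
  pose proof (tf_path h (t - h) i j j ltac:(lra) ltac:(lra)) as Hp.
  replace (h + (t - h)) with t in Hp by ring.
  apply Rlt_le_trans with (2 := Hp). apply Rmult_lt_0_compat; [assumption | ].
  apply tf_diag_pos. lra.
Qed.
End Transition.

(** * Existence of the decay parameter *)

(** Fekete's lemma.  [L] is the infimum of [a t / t]; an almost optimal period [T] is
    iterated, and boundedness on [0, T] controls the remainder. *)
Lemma subadditive_rate (a : R -> R) :
  (forall t, 0 <= t -> 0 <= a t) ->
  (forall s t, 0 <= s -> 0 <= t -> a (s + t) <= a s + a t) ->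
  (forall T, exists M, forall t, 0 <= t <= T -> a t <= M) ->
  exists L, (forall t, 0 <= t -> L * t <= a t) /\
    forall eps, 0 < eps -> exists M, forall t, 0 <= t -> a t <= (L + eps) * t + M.
Proof.
  intros Hpos Hsub Hbnd.
  destruct (completeness (fun x => forall t, 0 <= t -> x * t <= a t)) as [L [Hub Hlub]].
  - exists (a 1). intros x Hx. specialize (Hx 1 ltac:(lra)). lra.
  - exists 0. intros t Ht. specialize (Hpos t Ht). lra.
  - exists L. split.
    + intros t Ht. destruct (Rle_lt_or_eq_dec 0 t Ht) as [Ht' | <-].
      * apply Rmult_le_reg_r with (/ t); [now apply Rinv_0_lt_compat | ].
        rewrite Rmult_assoc, Rinv_r, Rmult_1_r by lra. apply Hlub. intros x Hx.
        apply Rmult_le_reg_r with t; [assumption | ].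
        rewrite Rmult_assoc, Rinv_l, Rmult_1_r by lra. now apply Hx.
      * rewrite Rmult_0_r. apply Hpos. lra.
    + intros eps Heps.
      destruct (not_all_ex_not _ (fun t => 0 <= t -> (L + eps) * t <= a t)) as [T HT].
      { intro H. specialize (Hub _ H). lra. }
      apply imply_to_and in HT. destruct HT as [HT0 HT]. apply Rnot_le_lt in HT.
      assert (HTpos : 0 < T).
      { destruct (Rle_lt_or_eq_dec 0 T HT0) as [ | <-]; [assumption | ].
        specialize (Hpos 0 HT0). lra. }
      destruct (Hbnd T) as [M HM]. exists M.
      assert (Hn : forall n r, 0 <= r <= T ->
        a (INR n * T + r) <= (L + eps) * (INR n * T) + a r).
      { induction n as [|n IH]; intros r Hr.
        - simpl. rewrite !Rmult_0_l, Rmult_0_r, !Rplus_0_l. lra.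
        - rewrite S_INR. replace ((INR n + 1) * T + r) with (T + (INR n * T + r)) by ring.
          pose proof (pos_INR n).
          assert (0 <= INR n * T) by (apply Rmult_le_pos; lra).
          specialize (Hsub T (INR n * T + r) HT0 ltac:(lra)). specialize (IH r Hr). lra. }
      intros t Ht. destruct (nfloor_ex (t / T)) as [n Hfl].
      { apply Rdiv_le_0_compat; lra. }
      assert (Hfl1 : INR n * T <= t).
      { replace t with (t / T * T) by (field; lra). apply Rmult_le_compat_r; lra. }
      assert (Hfl2 : t <= (INR n + 1) * T).
      { replace t with (t / T * T) by (field; lra). apply Rmult_le_compat_r; lra. }
      specialize (Hn n (t - INR n * T) ltac:(lra)). specialize (HM (t - INR n * T) ltac:(lra)).
      replace (INR n * T + (t - INR n * T)) with t in Hn by ring.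
      assert (0 <= L).
      { apply Hub. intros x Hx. rewrite Rmult_0_l. now apply Hpos. }
      assert ((L + eps) * (INR n * T) <= (L + eps) * t) by (apply Rmult_le_compat_l; lra).
      lra.
Qed.

Lemma linear_bounds_lim (f : R -> R) (L t0 C : R) :
  (forall t, t0 <= t -> L * t - C <= f t) ->
  (forall eps, 0 < eps -> exists M, forall t, t0 <= t -> f t <= (L + eps) * t + M) ->
  is_lim (fun t => / t * f t) p_infty L.
Proof.
  intros Hlow Hup. apply is_lim_spec. intros eps. cbn [Rbar_locally'].
  destruct (Hup (eps / 2)) as [M HM]; [pose proof (cond_pos eps); lra | ].
  pose proof (cond_pos eps) as He.
  exists (Rmax (Rmax t0 1) (Rmax (Rabs C / (eps / 2)) (Rabs M / (eps / 2)))).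
  intros t Ht.
  pose proof (Rmax_l (Rmax t0 1) (Rmax (Rabs C / (eps / 2)) (Rabs M / (eps / 2)))).
  pose proof (Rmax_r (Rmax t0 1) (Rmax (Rabs C / (eps / 2)) (Rabs M / (eps / 2)))).
  pose proof (Rmax_l t0 1). pose proof (Rmax_r t0 1).
  pose proof (Rmax_l (Rabs C / (eps / 2)) (Rabs M / (eps / 2))).
  pose proof (Rmax_r (Rabs C / (eps / 2)) (Rabs M / (eps / 2))).
  assert (Hbig : forall x, Rabs x / (eps / 2) < t -> x < eps / 2 * t).
  { intros x Hx. apply Rle_lt_trans with (1 := Rle_abs x).
    replace (Rabs x) with (eps / 2 * (Rabs x / (eps / 2))) by (field; lra).
    apply Rmult_lt_compat_l; lra. }
  pose proof (Hbig C ltac:(lra)). pose proof (Hbig M ltac:(lra)).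
  specialize (Hlow t ltac:(lra)). specialize (HM t ltac:(lra)).
  replace (/ t * f t - L) with (/ t * (f t - L * t)) by (field; lra).
  rewrite Rabs_mult, Rabs_pos_eq by (left; apply Rinv_0_lt_compat; lra).
  apply Rmult_lt_reg_l with t; [lra | ]. rewrite <- Rmult_assoc, Rinv_r, Rmult_1_l by lra.
  apply Rabs_def1; lra.
Qed.

Lemma ln_le_of_mult3 (x y z v : R) : 0 < x -> 0 < y -> 0 < z -> x * y * z <= v ->
  ln x + ln y + ln z <= ln v.
Proof.
  intros Hx Hy Hz H.
  assert (0 < x * y) by now apply Rmult_lt_0_compat.
  rewrite <- !ln_mult by assumption. apply ln_le; [now apply Rmult_lt_0_compat | assumption].
Qed.

(** Travelling between [i], [j] and the base state 1 in unit times sandwiches [P t i j]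
    between constant multiples of [P (t - 2) 1 1] and [P (t + 2) 1 1]. *)
Lemma decay_parameter_exists (P : R -> nat -> nat -> R) :
  transition_function P ->
  (forall i j, (1 <= i)%nat -> (1 <= j)%nat -> reach P i j) ->
  exists L, is_decay_parameter P L /\ forall t, 0 <= t -> P t 1%nat 1%nat <= exp (- (L * t)).
Proof.
  intros HP Hirr.
  assert (Hdp : forall t, 0 <= t -> 0 < P t 1%nat 1%nat) by (intros; now apply tf_diag_pos).
  destruct (subadditive_rate (fun t => - ln (P t 1%nat 1%nat))) as [L [Hlow Hup]].
  - intros t Ht. pose proof (ln_le _ _ (Hdp t Ht) (tf_le1 P HP t 1 1 Ht)).
    rewrite ln_1 in H. lra.
  - intros s t Hs Ht. pose proof (tf_path P HP s t 1 1 1 Hs Ht) as Hp.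
    apply ln_le in Hp; [ | apply Rmult_lt_0_compat; auto].
    rewrite ln_mult in Hp by auto. lra.
  - intros T. destruct (tf_diag_lower P HP 1 T) as [m [Hm Hle]].
    exists (- ln m). intros t Ht. pose proof (ln_le _ _ Hm (Hle t Ht)). lra.
  - exists L. split.
    + intros i j Hi Hj.
      apply is_lim_ext with (fun t => / t * - ln (P t i j)); [intro t; ring | ].
      apply linear_bounds_lim with (t0 := 2)
        (C := - ln (P 1 1%nat i) - ln (P 1 j 1%nat) + - (L * 2)).
      * intros t Ht.
        pose proof (Hirr 1%nat i (le_n _) Hi 1 ltac:(lra)) as H1.
        pose proof (Hirr j 1%nat Hj (le_n _) 1 ltac:(lra)) as H2.
        pose proof (Hirr i j Hi Hj t ltac:(lra)) as H3.
        specialize (Hlow (1 + t + 1) ltac:(lra)).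
        pose proof (tf_path P HP 1 t 1 i j ltac:(lra) ltac:(lra)) as Hp1.
        pose proof (tf_path P HP (1 + t) 1 1 j 1 ltac:(lra) ltac:(lra)) as Hp2.
        pose proof (ln_le_of_mult3 _ _ _ (P (1 + t + 1) 1%nat 1%nat) H1 H3 H2) as Hln.
        assert (P 1 1%nat i * P t i j * P 1 j 1%nat <= P (1 + t + 1) 1%nat 1%nat).
        { apply Rle_trans with (2 := Hp2). apply Rmult_le_compat_r; lra. }
        specialize (Hln H). lra.
      * intros eps Heps. destruct (Hup eps Heps) as [M HM].
        exists (M - (L + eps) * 2 - ln (P 1 i 1%nat) - ln (P 1 1%nat j)).
        intros t Ht.
        pose proof (Hirr i 1%nat Hi (le_n _) 1 ltac:(lra)) as H1.
        pose proof (Hirr 1%nat j (le_n _) Hj 1 ltac:(lra)) as H2.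
        pose proof (Hdp (t - 2) ltac:(lra)) as H3.
        specialize (HM (t - 2) ltac:(lra)).
        pose proof (tf_path P HP 1 (t - 2) i 1 1 ltac:(lra) ltac:(lra)) as Hp1.
        pose proof (tf_path P HP (1 + (t - 2)) 1 i 1 j ltac:(lra) ltac:(lra)) as Hp2.
        replace (1 + (t - 2) + 1) with t in Hp2 by ring.
        pose proof (ln_le_of_mult3 _ _ _ (P t i j) H1 H3 H2) as Hln.
        assert (P 1 i 1%nat * P (t - 2) 1%nat 1%nat * P 1 1%nat j <= P t i j).
        { apply Rle_trans with (2 := Hp2). apply Rmult_le_compat_r; lra. }
        specialize (Hln H). lra.
    + intros t Ht. specialize (Hlow t Ht).
      rewrite <- (exp_ln (P t 1%nat 1%nat)) by auto.
      destruct (Req_dec (ln (P t 1%nat 1%nat)) (- (L * t))) as [-> | Hne]; [lra | ].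
      left. apply exp_increasing. lra.
Qed.

(** * Right derivatives *)

Lemma right_deriv_upper (g : R -> R) (t l eps : R) :
  is_derive g t l -> 0 < eps -> at_right 0 (fun h => g (t + h) <= g t + (l + eps) * h).
Proof.
  intros H Heps. apply is_derive_Reals in H. destruct (H eps Heps) as [d Hd].
  apply at_right_intro with d; [apply cond_pos | ]. intros h Hh.
  specialize (Hd h ltac:(lra) ltac:(rewrite Rabs_pos_eq; lra)).
  apply Rabs_def2 in Hd.
  assert ((g (t + h) - g t) / h * h <= (l + eps) * h) by (apply Rmult_le_compat_r; lra).
  replace ((g (t + h) - g t) / h * h) with (g (t + h) - g t) in H0 by (field; lra). lra.
Qed.

(** If [g c > g a], tilting [g] by the slope of its chord makes the values at [a] and [c]
    equal, so the tilted function has a minimum before [c]; there the right derivative of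
    [g] is at least the slope. *)
Lemma right_deriv_nonincreasing (g : R -> R) (a c : R) :
  a <= c -> (forall t, continuity_pt g t) ->
  (forall t eps, a <= t -> 0 < eps -> at_right 0 (fun h => g (t + h) <= g t + eps * h)) ->
  g c <= g a.
Proof.
  intros Hac Hcont Hder. apply Rnot_lt_le. intro Hlt.
  assert (Hlt' : a < c).
  { destruct (Rle_lt_or_eq_dec a c Hac) as [ | <-]; [assumption | lra]. }
  set (sl := (g c - g a) / (c - a)).
  assert (Hsl : 0 < sl) by (apply Rdiv_lt_0_compat; lra).
  assert (Hslc : sl * (c - a) = g c - g a) by (unfold sl; field; lra).
  destruct (continuity_ab_min (fun t => g t - sl * (t - a)) a c Hac) as [m [Hmin Hm]].
  { intros t _. apply continuity_pt_minus; [apply Hcont | ].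
    apply derivable_continuous_pt, ex_derive_Reals_0. auto_derive. exact I. }
  assert (Hm' : exists m', a <= m' < c /\
     forall t, a <= t <= c -> g m' - sl * (m' - a) <= g t - sl * (t - a)).
  { destruct (Rle_lt_or_eq_dec m c (proj2 Hm)) as [Hmc | ->].
    - exists m. split; [lra | exact Hmin].
    - exists a. split; [lra | ]. intros t Ht. specialize (Hmin t Ht). lra. }
  destruct Hm' as [m' [Hm' Hmin']].
  destruct (at_right_elim _ _ (Hder m' (sl / 2) ltac:(lra) ltac:(lra))) as [d [Hd Hh]].
  set (h := Rmin (d / 2) (c - m')).
  assert (0 < h /\ h <= d / 2 /\ h <= c - m').
  { unfold h. repeat split; [apply Rmin_glb_lt; lra | apply Rmin_l | apply Rmin_r]. }
  specialize (Hh h ltac:(lra)). specialize (Hmin' (m' + h) ltac:(lra)). nra.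
Qed.

(** * The quadratic branching rates *)

Section Rates.
Variable b : nat -> R.
Hypothesis Hb : branching_law b.

Lemma rate_series_0 (x : nat -> R) : is_series (fun k => qmbp_q b 0 k * x k) 0.
Proof.
  eapply is_series_ext; [ | exact (is_series_single 0 (fun _ => 0))].
  intro k. unfold qmbp_q. simpl. destruct k; simpl; ring.
Qed.

(** From state [n + 1], the entry with offspring number [m] leads to [n + m]. *)
Lemma rate_series_S (x : nat -> R) (n : nat) (l : R) :
  is_series (fun m => b m * x (n + m)%nat) l ->
  is_series (fun k => qmbp_q b (S n) k * x k) (INR (S n) ^ 2 * l).
Proof.
  intros H.
  assert (Hshift : is_series (fun m => qmbp_q b (S n) (n + m) * x (n + m)%nat)
                     (INR (S n) ^ 2 * l)).
  { eapply is_series_ext; [ | exact (is_series_scal (INR (S n) ^ 2) _ _ H)].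
    intro m. unfold qmbp_q. destruct (Nat.leb_spec (S n) (n + m + 1)); [ | lia].
    replace (n + m + 1 - S n)%nat with m by lia.
    change (INR (S n) ^ 2 * (b m * x (n + m)%nat) = INR (S n) ^ 2 * b m * x (n + m)%nat).
    ring. }
  destruct n as [|n]; [exact Hshift | ].
  apply (is_series_decr_n _ (S n)); [lia | ].
  assert (E : sum_n (fun k => qmbp_q b (S (S n)) k * x k) n = 0 :> R).
  { assert (Hz : forall N, (N <= n)%nat ->
      sum_n (fun k => qmbp_q b (S (S n)) k * x k) N = 0 :> R).
    { assert (Hq0 : forall k, (k <= n)%nat -> qmbp_q b (S (S n)) k = 0).
      { intros k Hk. unfold qmbp_q.
        destruct (Nat.leb_spec (S (S n)) (k + 1)); [lia | reflexivity]. }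
      induction N as [|N IH]; intros HN.
      - rewrite sum_O, Hq0 by lia. ring.
      - rewrite sum_Sn, IH, Hq0 by lia. unfold plus; simpl. ring. }
    now apply Hz. }
  assert (E' : plus (INR (S (S n)) ^ 2 * l)
      (opp (sum_n (fun k => qmbp_q b (S (S n)) k * x k) (pred (S n))))
      = INR (S (S n)) ^ 2 * l :> R).
  { simpl pred. rewrite E. unfold plus, opp; simpl. ring. }
  exact (eq_ind _ (is_series _) Hshift _ (eq_sym E')).
Qed.

Lemma rate_conservative (i : nat) : is_series (qmbp_q b i) 0.
Proof.
  apply is_series_ext with (fun k => qmbp_q b i k * 1); [intro; apply Rmult_1_r | ].
  destruct i as [|n]; [exact (rate_series_0 (fun _ => 1)) | ].
  replace 0 with (INR (S n) ^ 2 * 0) by ring.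
  apply (rate_series_S (fun _ => 1)). eapply is_series_ext; [ | exact (law_series b Hb)].
  intro m. symmetry. apply Rmult_1_r.
Qed.

Lemma rate_to_zero (i : nat) : qmbp_q b i 0 = if Nat.eqb 1 i then b 0%nat else 0.
Proof.
  unfold qmbp_q. destruct i as [|[|i]]; simpl; try ring.
Qed.

Hypothesis Hsub : subcritical b.

Lemma rate_identity (i : nat) :
  exists l, l <= 0 /\ is_series (fun k => qmbp_q b i k * INR k) l.
Proof.
  destruct i as [|n]; [exists 0; split; [lra | apply rate_series_0] | ].
  exists (INR (S n) ^ 2 * (1 * (m_b b - b 0%nat) + INR (S n) * 0)). split.
  - destruct Hsub as [_ Hm]. assert (0 <= INR (S n) ^ 2) by apply pow2_ge_0. nra.
  - apply rate_series_S. eapply is_series_ext;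
      [ | exact (is_series_lincomb _ _ 1 (INR (S n)) _ _ (law_drift b Hsub) (law_series b Hb))].
    intro m. cbv beta. rewrite plus_INR, S_INR.
    real_equation. ring.
Qed.

(** A bounded increasing concave function whose increments decay like [1 / k ^ 2], the
    inverse of the speed of the chain. *)
Definition weight (k : nat) : R := INR k / (INR k + 1).

Lemma weight_bounds (k : nat) : 0 <= weight k <= 1.
Proof.
  pose proof (pos_INR k). unfold weight. split.
  - apply Rdiv_le_0_compat; lra.
  - apply Rmult_le_reg_r with (INR k + 1); [lra | ].
    unfold Rdiv. rewrite Rmult_assoc, Rinv_l by lra. lra.
Qed.

(** Concavity at [n + 1], with the slope of the increment to the left.  The equality at
    [m = 1] is needed because [b 1] is negative. *)
Lemma weight_tangent (n m : nat) :
  (m = 1%nat -> weight (n + m) = weight (S n)) /\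
  weight (n + m) <= weight (S n) + (INR m - 1) / ((INR n + 1) * (INR n + 2)).
Proof.
  split; [intros ->; f_equal; lia | ].
  unfold weight. rewrite S_INR, plus_INR. pose proof (pos_INR n).
  destruct m as [|m].
  - simpl. right. field. lra.
  - rewrite S_INR. pose proof (pos_INR m). set (x := INR n) in *. set (y := INR m) in *.
    replace ((x + (y + 1)) / (x + (y + 1) + 1))
      with ((x + 1) / (x + 1 + 1) + y / ((x + 2) * (x + y + 2))) by (field; lra).
    apply Rplus_le_compat_l. replace (y + 1 - 1) with y by ring.
    apply Rmult_le_compat_l; [assumption | ].
    apply Rinv_le_contravar; [apply Rmult_lt_0_compat; lra | nra].
Qed.

Lemma rate_weight (i : nat) :
  exists l, l <= - (b 0%nat - m_b b) * weight i /\ is_series (fun k => qmbp_q b i k * weight k) l.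
Proof.
  destruct i as [|n].
  { exists 0. split; [unfold weight; simpl; lra | apply rate_series_0]. }
  assert (Hex : ex_series (fun m => b m * weight (n + m))).
  { apply (ex_series_le (K := R_AbsRing) (V := R_CompleteNormedModule) _
           (fun m => Rabs (b m))); [ | now apply law_abs_summable].
    intro m. change (Rabs (b m * weight (n + m)) <= Rabs (b m)).
    pose proof (weight_bounds (n + m)). rewrite Rabs_mult, (Rabs_pos_eq (weight _)) by lra.
    pose proof (Rabs_pos (b m)). nra. }
  destruct Hex as [l Hl]. exists (INR (S n) ^ 2 * l). split; [ | now apply rate_series_S].
  pose proof (pos_INR n).
  assert (Hle : l <= weight (S n) * 0
      + / ((INR n + 1) * (INR n + 2)) * (m_b b - b 0%nat)).
  { refine (is_series_le _ _ _ _ _ Hl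
      (is_series_lincomb _ _ _ _ _ _ (law_series b Hb) (law_drift b Hsub))).
    intro m. cbv beta. destruct (weight_tangent n m) as [H1 H2].
    destruct (Nat.eq_dec m 1) as [-> | Hm].
    - rewrite H1 by reflexivity. simpl (INR 1). right. ring.
    - pose proof (bl_nonneg b Hb m Hm).
      apply Rle_trans with (b m * (weight (S n) + (INR m - 1) / ((INR n + 1) * (INR n + 2)))).
      + apply Rmult_le_compat_l; assumption.
      + right. unfold Rdiv. ring. }
  replace (- (b 0%nat - m_b b) * weight (S n)) with
    (INR (S n) ^ 2 * (weight (S n) * 0 + / ((INR n + 1) * (INR n + 2)) * (m_b b - b 0%nat)))
    by (unfold weight; rewrite S_INR; field; lra).
  apply Rmult_le_compat_l; [apply pow2_ge_0 | assumption].
Qed.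
End Rates.

(** * The decay parameter *)

Section Process.
Variable b : nat -> R.
Hypothesis Hb : branching_law b.
Hypothesis Hsub : subcritical b.
Variable P : R -> nat -> nat -> R.
Hypothesis HP : transition_function P.
Hypothesis Hq : has_qmatrix P (qmbp_q b).

Lemma reach_down (i n : nat) : (1 <= i)%nat -> reach P (i + n) i.
Proof.
  intros Hi. induction n as [|n IH].
  - rewrite Nat.add_0_r. now apply reach_refl.
  - apply reach_trans with (i + n)%nat; [assumption | | exact IH].
    apply (reach_rate P HP (qmbp_q b)); [assumption | lia | ].
    unfold qmbp_q. destruct (Nat.leb_spec (i + S n) (i + n + 1)); [ | lia].
    replace (i + n + 1 - (i + S n))%nat with 0%nat by lia.
    apply Rmult_lt_0_compat; [ | apply (bl_death b Hb)].
    apply pow_lt, lt_0_INR. lia.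
Qed.

Lemma law_some_birth : exists k, 0 < b (k + 2)%nat.
Proof.
  apply NNPP. intro Hno.
  assert (Hz : forall k, b (k + 2)%nat = 0).
  { intro k. apply Rle_antisym; [ | apply (bl_nonneg b Hb); lia].
    apply Rnot_lt_le. intro. apply Hno. now exists k. }
  pose proof (bl_birth b Hb) as Hbirth.
  rewrite (is_series_unique _ 0) in Hbirth; [lra | ].
  eapply is_series_ext; [ | exact (is_series_single 0 (fun _ => 0))].
  intro k. cbv beta. rewrite Hz. now destruct (Nat.eqb 0 k).
Qed.

Lemma reach_up (i n : nat) : (1 <= i)%nat -> exists j, (i + n <= j)%nat /\ reach P i j.
Proof.
  intros Hi. destruct law_some_birth as [k Hk]. induction n as [|n [j [Hj IH]]].
  - exists i. split; [lia | now apply reach_refl].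
  - exists (j + k + 1)%nat. split; [lia | ].
    apply reach_trans with j; [assumption | exact IH | ].
    apply (reach_rate P HP (qmbp_q b)); [assumption | lia | ].
    unfold qmbp_q. destruct (Nat.leb_spec j (j + k + 1 + 1)); [ | lia].
    replace (j + k + 1 + 1 - j)%nat with (k + 2)%nat by lia.
    apply Rmult_lt_0_compat; [ | assumption].
    apply pow_lt, lt_0_INR. lia.
Qed.

Lemma irreducible (i j : nat) : (1 <= i)%nat -> (1 <= j)%nat -> reach P i j.
Proof.
  intros Hi Hj. destruct (reach_up i j Hi) as [k [Hk Hik]].
  apply reach_trans with k; [assumption | assumption | ].
  replace k with (j + (k - j))%nat by lia. now apply reach_down.
Qed.

Lemma INR_proper (M : R) : exists N, forall k, (N < k)%nat -> M < INR k.
Proof.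
  destruct (INR_unbounded M) as [N HN]. exists N. intros k Hk. apply lt_INR in Hk. lra.
Qed.

(** Comparison with the indicator of 0 plus [b 0 * t]: the generator applied to that
    indicator equals [b 0] at state 1 and vanishes elsewhere. *)
Lemma extinction_upper (i : nat) (t : R) : 0 <= t -> P t i 0%nat <= delta i 0 + b 0%nat * t.
Proof.
  intros Ht. pose proof (bl_death b Hb) as Hb0.
  assert (Hmain : P (Rabs t) i 0%nat <= delta i 0 + b 0%nat * t);
    [ | rewrite Rabs_pos_eq in Hmain by assumption; exact Hmain].
  apply (comparison P (qmbp_q b) (tf_nonneg P HP) Hq (rate_conservative b Hb)
    INR pos_INR INR_proper (rate_identity b Hb Hsub)
    (fun k s => P (Rabs s) k 0%nat) (fun k s => tf_continuity P HP k 0 s)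
    (fun k s => tf_le1 P HP (Rabs s) k 0 (Rabs_pos s)))
    with (w := fun k s => delta k 0 + b 0%nat * s) (dw := fun _ _ => b 0%nat); try assumption.
  - intros K k s h Hs Hh. rewrite !Rabs_pos_eq by lra. now apply tf_step.
  - intros k s. auto_derive; [exact I | ring].
  - intros k s Hs. unfold delta. assert (0 <= b 0%nat * s) by (apply Rmult_le_pos; lra).
    destruct (Nat.eqb k 0); lra.
  - intros k. rewrite Rabs_R0, (tf_zero P HP). lra.
  - intros k s Hs. exists (qmbp_q b k 0 + b 0%nat * s * 0). split.
    + rewrite rate_to_zero. destruct (Nat.eqb 1 k); lra.
    + replace (qmbp_q b k 0 + b 0%nat * s * 0)
        with (1 * qmbp_q b k 0 + b 0%nat * s * 0) by ring.
      eapply is_series_ext; [ | exact (is_series_lincomb _ _ 1 (b 0%nat * s) _ _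
         (is_series_single 0 (qmbp_q b k)) (rate_conservative b Hb k))].
      intro j. unfold delta.
      real_equation.
      destruct j; simpl; ring.
Qed.

(** Comparison of [1 - P t i 0] with a decaying multiple of [weight]; the factor 2 is what
    makes [2 * weight k >= 1] for [k >= 1].  It bounds the probability of survival together
    with any lost mass, so absorption is certain. *)
Lemma extinction_lower (i : nat) (t : R) : 0 <= t ->
  1 - P t i 0%nat <= 2 * weight i * exp (- ((b 0%nat - m_b b) * t)).
Proof.
  intros Ht. set (c := b 0%nat - m_b b).
  assert (Hmain : 1 - P (Rabs t) i 0%nat <= 2 * weight i * exp (- (c * t)));
    [ | rewrite Rabs_pos_eq in Hmain by assumption; exact Hmain].
  refine (comparison P (qmbp_q b) (tf_nonneg P HP) Hq (rate_conservative b Hb)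
    INR pos_INR INR_proper (rate_identity b Hb Hsub)
    (fun k s => 1 - P (Rabs s) k 0%nat) _ _ _
    (fun k s => 2 * weight k * exp (- (c * s)))
    (fun k s => - c * (2 * weight k * exp (- (c * s)))) _ _ _ _ i t Ht).
  - intros k s. apply continuity_pt_minus;
      [now apply continuity_pt_const | now apply tf_continuity].
  - intros k s. pose proof (tf_nonneg P HP (Rabs s) k 0 (Rabs_pos s)). lra.
  - intros K k s h Hs Hh. rewrite !Rabs_pos_eq by lra. now apply tf_step_compl.
  - intros k s. auto_derive; [exact I | ring].
  - intros k s Hs. pose proof (weight_bounds k). pose proof (exp_pos (- (c * s))).
    apply Rmult_le_pos; lra.
  - intros k. rewrite Rabs_R0, (tf_zero P HP), Rmult_0_r, Ropp_0, exp_0.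
    unfold delta. destruct k as [|k]; simpl Nat.eqb; cbv iota.
    + unfold weight; simpl; lra.
    + unfold weight. rewrite S_INR. pose proof (pos_INR k).
      apply Rmult_le_reg_r with (INR k + 1 + 1); [lra | ]. field_simplify; lra.
  - intros k s Hs. destruct (rate_weight b Hb Hsub k) as [l [Hl Hser]].
    exists (2 * exp (- (c * s)) * l). split.
    + replace (- c * (2 * weight k * exp (- (c * s))))
        with (2 * exp (- (c * s)) * (- c * weight k)) by ring.
      apply Rmult_le_compat_l; [pose proof (exp_pos (- (c * s))); lra | exact Hl].
    + eapply is_series_ext; [ | exact (is_series_scal (2 * exp (- (c * s))) _ _ Hser)].
      intro j. cbv beta.
      change (2 * exp (- (c * s)) * (qmbp_q b k j * weight j)
              = qmbp_q b k j * (2 * weight j * exp (- (c * s)))). ring.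
Qed.

(** Chapman-Kolmogorov with the states beyond [K] estimated by [extinction_upper]: they
    contribute at most the tail of row 1, uniformly in [h]. *)
Lemma extinction_increment (K : nat) (t h : R) : 0 <= t -> 0 < h ->
  (P (t + h) 1%nat 0%nat - P t 1%nat 0%nat) / h <=
    b 0%nat * (Series (P t 1%nat) - sum_n (P t 1%nat) K)
    + sum_n (fun k => P t 1%nat k * ((P h k 0%nat - delta k 0) / h)) K.
Proof.
  intros Ht Hh.
  set (m := Series (P t 1%nat)).
  assert (Hser : is_series
     (fun k => P t 1%nat k * (delta k 0 + b 0%nat * h - P h k 0%nat))
     (1 * (1 * P t 1%nat 0%nat + b 0%nat * h * m) + -1 * P (t + h) 1%nat 0%nat)).
  { eapply is_series_ext; [ | exact (is_series_lincomb _ _ 1 (-1) _ _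
      (is_series_lincomb _ _ 1 (b 0%nat * h) _ _ (is_series_single 0 (P t 1%nat))
        (tf_row P HP t 1 Ht)) (tf_semigroup P HP t h 1 0 Ht (Rlt_le _ _ Hh)))].
    intro k. unfold delta. cbv beta.
    real_equation.
    destruct k; simpl; ring. }
  pose proof (sum_n_le_series _ _ K Hser) as Hle.
  assert (Hsum : sum_n (fun k => P t 1%nat k * (delta k 0 + b 0%nat * h - P h k 0%nat)) K
    = h * (b 0%nat * sum_n (P t 1%nat) K
           - sum_n (fun k => P t 1%nat k * ((P h k 0%nat - delta k 0) / h)) K)).
  { clear Hle. induction K as [|K IH].
    - rewrite !sum_O. real_equation. field. lra.
    - rewrite !sum_Sn, IH. unfold plus; simpl. real_equation. field. lra. }
  rewrite Hsum in Hle.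
  apply Rmult_le_reg_r with h; [assumption | ].
  unfold Rdiv at 1. rewrite Rmult_assoc, Rinv_l, Rmult_1_r by lra.
  assert (Hle' := Hle ltac:(intros k _; apply Rmult_le_pos;
    [now apply (tf_nonneg P HP) | pose proof (extinction_upper k h); lra])).
  lra.
Qed.

Lemma extinction_right_deriv (t eps : R) : 0 <= t -> 0 < eps ->
  at_right 0 (fun h =>
    P (t + h) 1%nat 0%nat <= P t 1%nat 0%nat + (b 0%nat * P t 1%nat 1%nat + eps) * h).
Proof.
  intros Ht Heps. pose proof (bl_death b Hb) as Hb0.
  assert (Htail : exists K, (1 <= K)%nat /\
     b 0%nat * (Series (P t 1%nat) - sum_n (P t 1%nat) K) < eps / 2).
  { assert (Hpos : 0 < eps / (2 * b 0%nat)) by (apply Rdiv_lt_0_compat; lra).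
    destruct (proj1 (filterlim_locally _ _) (tf_row P HP t 1 Ht) (mkposreal _ Hpos)) as [N HN].
    exists (S N). split; [lia | ]. specialize (HN (S N) ltac:(lia)).
    change (Rabs (sum_n (P t 1%nat) (S N) - Series (P t 1%nat)) < eps / (2 * b 0%nat)) in HN.
    apply Rabs_def2 in HN.
    replace (eps / 2) with (b 0%nat * (eps / (2 * b 0%nat))) by (field; lra).
    apply Rmult_lt_compat_l; lra. }
  destruct Htail as [K [HK Htail]].
  assert (Hlim : filterlim
    (fun h => sum_n (fun k => P t 1%nat k * ((P h k 0%nat - delta k 0) / h)) K)
    (at_right 0) (locally (b 0%nat * P t 1%nat 1%nat))).
  { replace (b 0%nat * P t 1%nat 1%nat) with (sum_n (fun k => P t 1%nat k * qmbp_q b k 0) K).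
    - apply (right_lim_sum (fun k h => P t 1%nat k * ((P h k 0%nat - delta k 0) / h))).
      intros k _. apply right_lim_mult; [apply filterlim_const | apply Hq].
    - rewrite (sum_n_ext _ (fun k => if Nat.eqb 1 k then P t 1%nat k * b 0%nat else 0)).
      + rewrite sum_n_single. destruct (Nat.leb_spec 1 K); [apply Rmult_comm | lia].
      + intro k. rewrite rate_to_zero. destruct (Nat.eqb 1 k); [reflexivity | apply Rmult_0_r]. }
  assert (Heps2 : 0 < eps / 2) by lra.
  pose proof (proj1 (filterlim_locally _ _) Hlim (mkposreal _ Heps2)) as Hn.
  apply at_right_elim in Hn. destruct Hn as [d [Hd Hball]].
  apply at_right_intro with d; [assumption | ]. intros h Hh.
  specialize (Hball h Hh).
  change (Rabs (sum_n (fun k => P t 1%nat k * ((P h k 0%nat - delta k 0) / h)) K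
    - b 0%nat * P t 1%nat 1%nat) < eps / 2) in Hball.
  apply Rabs_def2 in Hball.
  pose proof (extinction_increment K t h Ht ltac:(lra)) as Hinc.
  assert (Hq' : (P (t + h) 1%nat 0%nat - P t 1%nat 0%nat) / h
            <= b 0%nat * P t 1%nat 1%nat + eps) by lra.
  apply Rmult_le_compat_r with (r := h) in Hq'; [ | lra].
  unfold Rdiv in Hq'. rewrite Rmult_assoc, Rinv_l, Rmult_1_r in Hq' by lra. lra.
Qed.

Variable L : R.
Hypothesis HL : forall t, 0 <= t -> P t 1%nat 1%nat <= exp (- (L * t)).

(** [P t 1 0 + (b 0 / L) exp (- L t)] is nonincreasing; it equals [b 0 / L] at time 0 and
    tends to 1. *)
Lemma decay_le_death_rate : 0 < L -> L <= b 0%nat.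
Proof.
  intros HLpos. pose proof (bl_death b Hb) as Hb0. pose proof (proj2 Hsub) as Hm.
  set (c := b 0%nat - m_b b). assert (Hc : 0 < c) by (unfold c; lra).
  set (e := fun s => b 0%nat / L * exp (- (L * s))).
  set (g := fun s => P (Rabs s) 1%nat 0%nat + e s).
  assert (Hder : forall s, is_derive e s (- (b 0%nat * exp (- (L * s))))).
  { intro s. unfold e. auto_derive; [exact I | field; lra]. }
  assert (Hdecr : forall T, 0 <= T -> g T <= g 0).
  { intros T HT. apply right_deriv_nonincreasing; [assumption | | ].
    - intro s. apply continuity_pt_plus; [now apply tf_continuity | ].
      apply derivable_continuous_pt, ex_derive_Reals_0. eexists. apply Hder.
    - intros t eps Ht Heps.
      destruct (at_right_elim _ _ (extinction_right_deriv t (eps / 2) Ht ltac:(lra)))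
        as [d1 [Hd1 H1]].
      destruct (at_right_elim _ _ (right_deriv_upper e t _ (eps / 2) (Hder t) ltac:(lra)))
        as [d2 [Hd2 H2]].
      apply at_right_intro with (Rmin d1 d2); [now apply Rmin_glb_lt | ].
      intros h Hh. pose proof (Rmin_l d1 d2). pose proof (Rmin_r d1 d2).
      specialize (H1 h ltac:(lra)). specialize (H2 h ltac:(lra)).
      unfold g. rewrite !Rabs_pos_eq by lra.
      assert (b 0%nat * P t 1%nat 1%nat * h <= b 0%nat * exp (- (L * t)) * h).
      { apply Rmult_le_compat_r; [lra | ]. apply Rmult_le_compat_l; [lra | now apply HL]. }
      lra. }
  assert (Hone : 1 <= b 0%nat / L).
  { apply Rnot_lt_le. intro Hlt.
    (* Chosen so that [exp (- (c T)) <= 1 / (1 + c T) < 1 - b 0 / L]. *)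
    set (T := / (c * (1 - b 0%nat / L))).
    assert (HT : 0 < T) by (apply Rinv_0_lt_compat, Rmult_lt_0_compat; lra).
    specialize (Hdecr T ltac:(lra)). unfold g, e in Hdecr.
    rewrite Rabs_R0, (tf_zero P HP), Rmult_0_r, Ropp_0, exp_0, Rabs_pos_eq in Hdecr by lra.
    change (delta 1 0) with 0 in Hdecr.
    pose proof (extinction_lower 1 T ltac:(lra)) as Hext. fold c in Hext.
    replace (2 * weight 1) with 1 in Hext by (unfold weight; simpl; field).
    assert (0 < b 0%nat / L) by (apply Rdiv_lt_0_compat; lra).
    assert (0 < b 0%nat / L * exp (- (L * T))) by (apply Rmult_lt_0_compat; [lra | apply exp_pos]).
    assert (HcT : c * T = / (1 - b 0%nat / L)) by
      (unfold T; rewrite Rinv_mult, <- Rmult_assoc, Rinv_r, Rmult_1_l by lra; reflexivity).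
    assert (Hexp : exp (- (c * T)) <= 1 - b 0%nat / L).
    { rewrite exp_Ropp. rewrite <- (Rinv_inv (1 - b 0%nat / L)).
      apply Rinv_le_contravar; [apply Rinv_0_lt_compat; lra | ].
      pose proof (exp_ineq1_le (c * T)). lra. }
    lra. }
  apply Rmult_le_reg_r with (/ L); [now apply Rinv_0_lt_compat | ].
  rewrite Rinv_r by lra. exact Hone.
Qed.

End Process.

(** In row 1, both [P t 1 1] and the lost mass are part of [1 - P t 1 0]. *)
Lemma decay_ge_drift (b : nat -> R) (P : R -> nat -> nat -> R) (L : R) :
  branching_law b -> subcritical b -> qmbp_transition_function b P ->
  is_decay_parameter P L -> b 0%nat - m_b b <= L.
Proof.
  intros Hb Hsub [HP Hq] HL. specialize (HL 1%nat 1%nat (le_n _) (le_n _)).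
  refine (is_lim_le_loc (fun _ => b 0%nat - m_b b) _ p_infty (b 0%nat - m_b b) L _
     (is_lim_const _ _) HL).
  exists 1. intros t Ht.
  pose proof (extinction_lower b Hb Hsub P HP Hq 1 t ltac:(lra)) as Hext.
  replace (2 * weight 1) with 1 in Hext by (unfold weight; simpl; field).
  assert (Hle : P t 1%nat 1%nat <= exp (- ((b 0%nat - m_b b) * t))).
  { pose proof (sum_n_le_series _ _ 1 (tf_row P HP t 1 ltac:(lra))
      (fun k _ => tf_nonneg P HP t 1 k ltac:(lra))) as Hs.
    rewrite sum_Sn, sum_O in Hs.
    change (P t 1%nat 0%nat + P t 1%nat 1%nat <= Series (P t 1%nat)) in Hs.
    pose proof (tf_mass P HP t 1 ltac:(lra)). lra. }
  apply ln_le in Hle; [ | apply tf_diag_pos; [assumption | lra]].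
  rewrite ln_exp in Hle.
  apply Rmult_le_reg_l with t; [lra | ].
  replace (t * - (/ t * ln (P t 1%nat 1%nat))) with (- ln (P t 1%nat 1%nat)) by (field; lra).
  lra.
Qed.

Theorem corollary2p1 (b : nat -> R) (Hb : branching_law b) (Hsub : subcritical b) :
  (Rbar_le (Finite (ln 2 ^ 2 / b 0%nat)) (D2 b) /\
   Rbar_le (D2 b) (Finite (ln 2 ^ 2 / (b 0%nat - m_b b)))) /\
  (forall P : R -> nat -> nat -> R, qmbp_transition_function b P ->
   exists lambdaC : R, is_decay_parameter P lambdaC /\
     (b 0%nat - m_b b) / (4 * ln 2 ^ 2) <= lambdaC <= b 0%nat / ln 2 ^ 2).
Proof.
  split; [now apply D2_bounds | ].
  intros P HPQ. pose proof HPQ as [HP Hq].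
  destruct (decay_parameter_exists P HP) as [L [HL HL1]].
  { intros i j Hi Hj. now apply (irreducible b Hb P HP Hq). }
  pose proof (decay_ge_drift b P L Hb Hsub HPQ HL) as Hge.
  pose proof (proj2 Hsub) as Hm. pose proof (bl_death b Hb) as H0.
  pose proof (decay_le_death_rate b Hb Hsub P HP Hq L HL1 ltac:(lra)) as Hle.
  pose proof ln_lt_2 as Hln.
  assert (Hln1 : ln 2 < 1).
  { rewrite <- (ln_exp 1). apply ln_increasing; [lra | ].
    pose proof (exp_ineq1 1 ltac:(lra)). lra. }
  assert (Hsq : / 4 < ln 2 ^ 2 < 1) by (split; nra).
  exists L. split; [exact HL | split].
  - apply Rle_trans with (2 := Hge).
    apply Rmult_le_reg_r with (4 * ln 2 ^ 2); [lra | ].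
    unfold Rdiv. rewrite Rmult_assoc, Rinv_l, Rmult_1_r by lra. nra.
  - apply Rle_trans with (1 := Hle).
    apply Rmult_le_reg_r with (ln 2 ^ 2); [lra | ].
    unfold Rdiv. rewrite Rmult_assoc, Rinv_l, Rmult_1_r by lra. nra.
Qed.
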